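(* Let $q,r$ be real piecewise continuous functions on $[a,b]$ such that the Dirichlet problem $-y''+q(x)y=\lambda r(x)y$, $y(a)=y(b)=0$ is non-definite, and let $y=\varphi+i\psi$ ($\varphi={\rm Re}\,y$, $\psi={\rm Im}\,y$) be a complex ghost belonging to a non-real eigenvalue $\lambda$ with ${\rm Im}\,\lambda>0$. Put $G(x)=\int_a^x r|y|^2\,dt$ and suppose $G(x)<0$ for all $x\in(a,b)$. Suppose $\psi'(b)>0$ and that $\psi$ has a zero in $(a,b)$; let $x_0\in(a,b)$ be the largest zero of $\psi$ in $(a,b)$. (1) If $\varphi'(b)>0$, then $\varphi(x)<0$ in $(x_0,b)$. (2) If $\varphi'(b)<0$, then $\varphi$ vanishes exactly once in $(x_0,b)$. (3) If $\varphi'(b)=0$, then the conclusion of one of the first two cases must occur, i.e. either $\varphi<0$ in $(x_0,b)$ or $\varphi$ vanishes exactly once in $(x_0,b)$.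
   Context: The problem is called non-definite if each of the quadratic forms $y\mapsto\int_a^b(|y'|^2+q|y|^2)\,dx$ and $y\mapsto\int_a^b r|y|^2\,dx$ takes both positive and negative values on the domain of the Dirichlet problem. Solutions are $C^1$ functions with absolutely continuous derivative satisfying the equation almost everywhere. A complex ghost is a non-trivial eigenfunction belonging to a non-real eigenvalue. *)

(* Defs.v *)
From mathcomp Require Import all_boot all_order all_algebra.
From mathcomp Require Import all_classical all_reals all_analysis.
From mathcomp Require Import complex.

Set Implicit Arguments.
Unset Strict Implicit.
Unset Printing Implicit Defensive.

Import Order.TTheory GRing.Theory Num.Theory.
Import numFieldNormedType.Exports.

Local Open Scope classical_set_scope.
Local Open Scope ring_scope.
Local Open Scope complex_scope.

Section Definitions.
Context {R : realType}.
Implicit Types (a b x : R) (f q r : R -> R) (y : R -> R[i]) (l : R[i]).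

(* [s] lists the breakpoints after [a], ending with [b]; the values of [f] at
   the breakpoints are unrestricted, but its one-sided limits there are finite. *)
Definition piecewise_continuous a b f : Prop :=
  exists2 s : seq R, itv_partition a b s &
    forall i, (i < size s)%N ->
      let u := nth b (a :: s) i in
      let v := nth b s i in
      [/\ {in `]u, v[, continuous f},
          cvg (f t @[t --> u^'+]) & cvg (f t @[t --> v^'-])].

(* Functions on [a, b] are represented by total functions, so differentiation is
   relative to [a, b]: two-sided inside, one-sided at the endpoints.  No value
   outside [a, b] is used. *)
Definition diff_quot f x : R -> R := fun t => (f t - f x) / (t - x).

Definition derivable_in a b f x : Prop :=
  cvg (diff_quot f x t @[t --> within `[a, b] x^']).

Definition deriv_in a b f x : R :=
  lim (diff_quot f x t @[t --> within `[a, b] x^']).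

Definition C1_on a b f : Prop :=
  {in `[a, b], forall x, derivable_in a b f x} /\
  {within `[a, b], continuous (deriv_in a b f)}.

Definition re_part y : R -> R := fun x => complex.Re (y x).
Definition im_part y : R -> R := fun x => complex.Im (y x).

Definition cderivable_in a b y x : Prop :=
  derivable_in a b (re_part y) x /\ derivable_in a b (im_part y) x.

Definition cderiv_in a b y x : R[i] :=
  deriv_in a b (re_part y) x +i* deriv_in a b (im_part y) x.

Definition cC1_on a b y : Prop :=
  C1_on a b (re_part y) /\ C1_on a b (im_part y).

(* real-valued modulus; the norm [`|z|] of [z : R[i]] has type [R[i]] *)
Definition cmod (z : R[i]) : R := ComplexField.Normc.normc z.

Definition abs_continuous a b y : Prop :=
  forall e : R, 0 < e -> exists2 d : R, 0 < d &
    forall (n : nat) (u v : 'I_n -> R),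
      (forall i, a <= u i /\ u i <= v i /\ v i <= b) ->
      trivIset setT (fun i : 'I_n => `]u i, v i[%classic) ->
      \sum_(i < n) (v i - u i) < d ->
      \sum_(i < n) cmod (y (v i) - y (u i)) < e.

Definition C1_AC_deriv a b y : Prop :=
  cC1_on a b y /\ abs_continuous a b (cderiv_in a b y).

Definition dirichlet_domain a b y : Prop :=
  [/\ C1_AC_deriv a b y, y a = 0 & y b = 0].

Definition energy_form a b q y : R :=
  \int[@lebesgue_measure R]_(x in `[a, b])
    (cmod (cderiv_in a b y x) ^+ 2 + q x * cmod (y x) ^+ 2).

Definition weight_form a b r y : R :=
  \int[@lebesgue_measure R]_(x in `[a, b]) (r x * cmod (y x) ^+ 2).

Definition takes_both_signs a b (form : (R -> R[i]) -> R) : Prop :=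
  (exists2 y, dirichlet_domain a b y & 0 < form y) /\
  (exists2 y, dirichlet_domain a b y & form y < 0).

Definition non_definite a b q r : Prop :=
  takes_both_signs a b (energy_form a b q) /\
  takes_both_signs a b (weight_form a b r).

Definition sl_solution a b q r l y : Prop :=
  C1_AC_deriv a b y /\
  {ae @lebesgue_measure R, forall x, x \in `[a, b] ->
    cderivable_in a b (cderiv_in a b y) x /\
    - cderiv_in a b (cderiv_in a b y) x + (q x)%:C * y x
      = l * (r x)%:C * y x}.

(* [y] is non-trivial as a function on [a, b] *)
Definition dirichlet_eigenfunction a b q r l y : Prop :=
  [/\ sl_solution a b q r l y, y a = 0, y b = 0 &
      exists2 x, x \in `[a, b] & y x != 0].

Definition complex_ghost a b q r l y : Prop :=
  complex.Im l != 0 /\ dirichlet_eigenfunction a b q r l y.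

Definition ghost_G a r y x : R :=
  \int[@lebesgue_measure R]_(t in `[a, x]) (r t * cmod (y t) ^+ 2).

Definition vanishes_once f (I : interval R) : Prop :=
  exists! x : R, x \in I /\ f x = 0.

End Definitions.

(* Main.v *)
Require Import Defs.
From mathcomp Require Import all_boot all_order all_algebra.
From mathcomp Require Import all_classical all_reals all_analysis measurable_realfun.
From mathcomp Require Import complex.
From mathcomp Require Import ring lra.

(** Since [y] solves the equation and [y a = 0], the Wronskian
    [W = phi * psi' - phi' * psi] has derivative [- Im l * r * |y|^2] almost everywhere and
    is absolutely continuous, so [W = - Im l * G], which is positive on [(a, b)].  On
    [(x0, b)], where [psi < 0], this makes [phi / psi] strictly decreasing, so [phi] vanishes
    there at most once; and [W x0 > 0] forces [phi x0 < 0].  The sign of [phi' b] decides the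
    sign of [phi] near [b], and the intermediate value theorem does the rest. *)

Import Order.TTheory GRing.Theory Num.Theory.
Import numFieldNormedType.Exports.

Local Open Scope classical_set_scope.
Local Open Scope ring_scope.
Local Open Scope complex_scope.

(** * Gauge induction and calculus of derivatives relative to a segment *)

Section Real.
Context {R : realType}.
Implicit Types (a b c x : R) (f : R -> R).

(** Cousin's lemma in inductive form: the supremum of the [x] with [P a x] lies within its own
    gauge, so it is attained, and it could be exceeded if it were below [b]. *)
Lemma segment_gauge_induction (P : R -> R -> Prop) a b : a <= b ->
  (forall u v w, u <= v -> v <= w -> P u v -> P v w -> P u w) ->
  (forall x, a <= x <= b -> exists2 d, 0 < d &
     forall u v, a <= u -> v <= b -> x - d < u -> u <= x -> x <= v ->
       v < x + d -> P u v) ->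
  P a b.
Proof.
move=> ab Ptrans Ploc.
pose S := [set x | a <= x <= b /\ P a x].
have Sa : S a.
  split; first by rewrite lexx.
  by have [|d d0 Pd] := Ploc a; [rewrite lexx | apply: Pd => //; lra].
have hS : has_sup S by split; [exists a | exists b => x [/andP[]]].
set s := sup S.
have as_ : a <= s by exact: sup_upper_bound Sa.
have sb : s <= b by apply: ge_sup; [exists a | move=> x [/andP[]]].
have [|d d0 Pd] := Ploc s; first by rewrite as_.
have [x [/andP[ax xb] Pax] sdx] := sup_adherent d0 hS.
have xs : x <= s by apply: sup_upper_bound => //; split=> //; apply/andP.
have Pas : P a s by apply: (Ptrans _ x) => //; apply: Pd => //; lra.
have [sltb|bs] := ltP s b; last by have -> : b = s by lra.
(* The gauge at [s] reaches this point, which lies beyond the supremum. *)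
pose v := Num.min b (s + d / 2).
have [vb vd sv] : [/\ v <= b, v <= s + d / 2 & s < v].
  by rewrite /v !ge_min !lexx orbT lt_min sltb; split=> //=; lra.
have Pav : P a v by apply: (Ptrans _ s) => //; [lra | apply: Pd => //; lra].
have : v <= s by apply: sup_upper_bound => //; split=> //; lra.
lra.
Qed.

(** Multiplying out the difference quotient lets [t = x] in; restricting [t] to the segment covers
    the endpoints as well. *)
Lemma derivable_inP a b f x : derivable_in a b f x ->
  forall e, 0 < e -> exists2 d, 0 < d &
    forall t, a <= t <= b -> `|t - x| < d ->
      `|f t - f x - deriv_in a b f x * (t - x)| <= e * `|t - x|.
Proof.
move=> fx e e0.
have : diff_quot f x t @[t --> within `[a, b] x^'] --> deriv_in a b f x by exact: fx.
move=> /cvgrPdist_le /(_ _ e0); rewrite !near_withinE near_nbhs.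
move=> /nbhs_ballP[d /= d0 fd]; exists d => // t tab tx.
have [->|tneqx] := eqVneq t x; first by rewrite !subrr mulr0 subr0 normr0 mulr0.
have /fd /(_ tneqx) : ball x d t by rewrite /ball/= distrC.
rewrite in_itv/= => /(_ tab).
have tx0 : t - x != 0 by rewrite subr_eq0.
have -> : f t - f x - deriv_in a b f x * (t - x) =
    - (deriv_in a b f x - diff_quot f x t) * (t - x).
  by rewrite /diff_quot; field.
by rewrite normrM normrN => h; apply: ler_wpM2r.
Qed.

Lemma derivable_in_is_derive a b f x : x \in `]a, b[ -> derivable_in a b f x ->
  is_derive x 1 f (deriv_in a b f x).
Proof.
rewrite in_itv/= => /andP[ax xb] fx.
have cv : h^-1 *: (f (h *: 1 + x) - f x) @[h --> 0^'] --> deriv_in a b f x.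
  apply/cvgrPdist_le => e e0; have [d d0 fd] := derivable_inP _ _ _ _ fx e e0.
  have m0 : 0 < Num.min d (Num.min (x - a) (b - x)).
    by rewrite !lt_min d0 !subr_gt0 ax.
  near=> h.
  have h0 : h != 0 by near: h; exact: nbhs_dnbhs_neq.
  have : `|h| < Num.min d (Num.min (x - a) (b - x)).
    by near: h; exact: dnbhs0_lt.
  rewrite !lt_min !ltr_norml => /and3P[hd ha hb].
  have := fd (h + x) _ _; rewrite addrK ltr_norml.
  rewrite (_ : h *: 1 = h); last by rewrite /GRing.scale/= mulr1.
  move=> fh; have {fh} : `|f (h + x) - f x - deriv_in a b f x * h| <= e * `|h|.
    by apply: fh; lra.
  move=> fh.
  have -> : deriv_in a b f x - h^-1 *: (f (h + x) - f x) =
      - h^-1 * (f (h + x) - f x - deriv_in a b f x * h).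
    by rewrite /GRing.scale/=; field.
  rewrite normrM normrN normfV mulrC ler_pdivrMr ?normr_gt0//.
split; first exact: (cvgP _ cv).
by apply: cvg_lim => //; exact: Rhausdorff.
Unshelve. all: by end_near. Qed.

(** The remainder is at most half the linear term, so the increment keeps the sign of that term. The
    product form treats both signs of the slope and both sides of [x] at once. *)
Lemma derivable_in_increment_sign a b f x :
  derivable_in a b f x -> deriv_in a b f x != 0 ->
  exists2 d, 0 < d & forall t, a <= t <= b -> `|t - x| < d -> t != x ->
    0 < deriv_in a b f x * ((f t - f x) * (t - x)).
Proof.
set D := deriv_in a b f x => fx D0.
have D20 : 0 < `|D| / 2 by rewrite divr_gt0// normr_gt0.
have [d d0 fd] := derivable_inP _ _ _ _ fx _ D20; exists d => // t tab td tx.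
have := fd t tab td; rewrite -/D; set E := _ - D * (t - x) => hE.
have m0 : 0 < `|D * (t - x)| by rewrite normr_gt0 mulf_neq0// subr_eq0.
have -> : D * ((f t - f x) * (t - x)) = `|D * (t - x)| ^+ 2 + D * (t - x) * E.
  by rewrite real_normK ?num_real// /E; ring.
have : `|D * (t - x) * E| <= `|D * (t - x)| * (`|D * (t - x)| / 2).
  by rewrite normrM ler_wpM2l// (le_trans hE)// normrM; lra.
by rewrite ler_norml => /andP[+ _]; nra.
Qed.

Lemma derivable_in_continuous a b f : {in `[a, b], forall x, derivable_in a b f x} ->
  {within `[a, b], continuous f}.
Proof.
move=> df; apply/subspace_continuousP => x /= xab.
have [d d0 fd] := derivable_inP _ _ _ _ (df x xab) 1 ltr01.
apply/cvgrPdist_le => e e0; rewrite near_withinE.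
set K := 1 + `|deriv_in a b f x|.
have K0 : 0 < K by rewrite ltr_pwDl.
have m0 : 0 < Num.min d (e / K) by rewrite lt_min d0 divr_gt0.
apply/nbhs_ballP; exists (Num.min d (e / K)) => // t; rewrite /ball/= distrC.
rewrite lt_min => /andP[td te]; rewrite in_itv/= => tab.
have {}fd := fd t tab td.
rewrite distrC.
have -> : f t - f x = (f t - f x - deriv_in a b f x * (t - x)) + deriv_in a b f x * (t - x).
  by rewrite subrK.
rewrite (le_trans (ler_normD _ _))// normrM.
rewrite (@le_trans _ _ (K * `|t - x|))//; first by rewrite /K mulrDl lerD2r.
by rewrite mulrC -ler_pdivlMr// ltW.
Qed.

Lemma continuous_segment_bounded a b f : {within `[a, b], continuous f} ->
  exists2 M, 0 < M & forall x, a <= x <= b -> `|f x| <= M.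
Proof.
move=> cf; have := continuous_compact cf (@segment_compact R a b).
move=> /compact_bounded[M [Mr fM]]; exists (`|M| + 1); first by rewrite ltr_wpDl.
move=> x xab; apply: fM; last by exists x.
by rewrite (le_lt_trans (ler_norm _))// ltrDl.
Qed.

Lemma C1_on_lipschitz a b f : C1_on a b f ->
  exists2 M, 0 < M & forall u v, a <= u -> u <= v -> v <= b -> `|f v - f u| <= M * (v - u).
Proof.
move=> [df cdf]; have [M M0 dM] := continuous_segment_bounded _ _ _ cdf.
exists M => // u v au uv vb.
have [||c] := @MVT_segment R f (deriv_in a b f) u v uv.
- move=> c cuv; apply: derivable_in_is_derive.
    by move: cuv; rewrite !in_itv/=; lra.
  by apply: df; move: cuv; rewrite !in_itv/=; lra.
- apply: continuous_subspaceW (derivable_in_continuous _ _ _ df) => x /=.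
  by rewrite !in_itv/=; lra.
- rewrite in_itv/= => cuv ->; rewrite normrM (ger0_norm (_ : 0 <= v - u)) ?subr_ge0//.
  by rewrite ler_wpM2r ?subr_ge0// dM//; lra.
Qed.

Lemma IVT_zero f u v : u <= v ->
  {within `[u, v], continuous f} -> f u * f v <= 0 ->
  exists2 c, u <= c <= v & f c = 0.
Proof.
move=> uv cf fuv; have [|c] := IVT (v := 0) uv cf.
  rewrite ge_min le_max; apply/andP; split; apply/orP.
    by have [fu|fu] := leP (f u) 0; [left|right; nra].
  by have [fu|fu] := leP 0 (f u); [left|right; nra].
by rewrite in_itv/=; exists c.
Qed.

End Real.

(** * Absolutely continuous functions with almost everywhere zero derivative *)

Section AbsolutelyContinuous.
Context {R : realType}.
Local Notation mu := (@lebesgue_measure R).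
Implicit Types (a b c x : R) (f : R -> R) (y : R -> R[i]).

(** Ordered lists of intervals, unlike indexed families, concatenate readily when neighbouring
    segments are glued. *)
Lemma abs_continuous_seq a b y : abs_continuous a b y ->
  forall e, 0 < e -> exists2 d, 0 < d & forall s : seq (R * R),
    all (fun p => (a <= p.1) && (p.1 <= p.2) && (p.2 <= b)) s ->
    pairwise (fun p p' => p.2 <= p'.1) s ->
    \sum_(p <- s) (p.2 - p.1) < d ->
    \sum_(p <- s) cmod (y p.2 - y p.1) < e.
Proof.
move=> ac e e0; have [d d0 H] := ac e e0; exists d => // s sab sp sd.
pose z := (0 : R, 0 : R).
have sumE (F : R * R -> R) : \sum_(p <- s) F p = \sum_(i < size s) F (nth z s i).
  by rewrite (big_nth z) big_mkord.
rewrite sumE; apply: (H _ (fun i => (nth z s i).1) (fun i => (nth z s i).2)).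
- by move=> i; have /(all_nthP z)/(_ i (ltn_ord i))/andP[/andP[]] := sab.
- apply/trivIsetP => i j _ _ ij.
  wlog {ij}ij : i j / (i < j)%N.
    move=> h; case: (ltngtP i j) => [|/h|/ord_inj/eqP]; [exact: h| |by rewrite (negbTE ij)].
    by rewrite setIC.
  have /(pairwiseP z)/(_ i j (ltn_ord i) (ltn_ord j) ij) := sp.
  move=> h; apply/seteqP; split=> // x [] /=; rewrite !in_itv/=.
  by case: (nth z s i) h => ? ?; case: (nth z s j) => ? ? /=; lra.
- by rewrite -(sumE (fun p => p.2 - p.1)).
Qed.

(* Cousin's gauge argument: away from a small open set [U] containing the exceptional null set
   the increments of [f] are controlled by the derivative, and on [U] by absolute continuity. *)
Lemma abs_continuous_derive0_const a b f : a <= b ->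
  abs_continuous a b (fun x => (f x)%:C) ->
  {ae mu, forall x, x \in `]a, b[ -> is_derive x 1 f 0} ->
  f b = f a.
Proof.
move=> ab ac [N [mN N0 NP]].
apply/eqP; rewrite -subr_eq0 -normr_le0; apply/ler_addgt0Pr => e e0; rewrite add0r.
(* The slope [e'] costs at most [e / 2] over the whole segment; the [+ 1] keeps the denominator
   positive when [a = b]. *)
set e' := e / (2 * (b - a + 1)).
have ba1 : 0 < b - a + 1 by lra.
have e'0 : 0 < e' by rewrite divr_gt0// mulr_gt0.
have e20 : 0 < e / 2 by lra.
have [d d0 acd] := abs_continuous_seq _ _ _ ac _ e20.
(* The derivative is controlled only inside []a, b[], so both endpoints join the exceptional set,
   which remains null. *)
pose Z := N `|` [set a; b].
have mab : measurable [set a; b] by apply: measurableU; exact: measurable_set1.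
have mZ : measurable Z by exact: measurableU.
have Z0 : mu Z = 0%E.
  apply/negligibleP => //; apply: negligibleU; first exact/negligibleP.
  apply: negligibleU; apply/negligibleP; try exact: measurable_set1;
    exact: lebesgue_measure_set1.
have Zoo : (mu Z < +oo)%E by rewrite Z0 ltry.
have [U [oU ZU mUZ]] := lebesgue_regularity_outer mZ Zoo d0.
have mU : measurable U by exact: open_measurable.
have {mUZ} mUd : (mu U < d%:E)%E.
  rewrite -(setDKU ZU) measureU//; [|exact: measurableD|by rewrite setDE -setIA setICl setI0].
  by rewrite [X in (_ + X)%E]Z0 adde0.
(* The list [s] is to hold the pieces inside [U], whose increments absolute continuity will bound;
   the remaining increment is charged to the slope [e']. Half-open segments make the measure
   additive under gluing. *)
pose P u v := exists s : seq (R * R),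
  [/\ all (fun p => (u <= p.1) && (p.1 <= p.2) && (p.2 <= v)) s,
      pairwise (fun p p' => p.2 <= p'.1) s,
      (\sum_(p <- s) (p.2 - p.1)%:E <= mu (U `&` `[u, v[%classic))%E &
      `|f v - f u| <= e' * (v - u) + \sum_(p <- s) `|f p.2 - f p.1|].
have [] : P a b.
  apply: segment_gauge_induction => //.
  - move=> u v w uv vw [s [su ss sU sf]] [t [tu tt tU tf]].
    exists (s ++ t); split.
    + rewrite all_cat; apply/andP; split.
        by apply: sub_all su => p /andP[/andP[-> ->]]/=; lra.
      by apply: sub_all tu => p /andP[/andP[? ->]]/=; lra.
    + rewrite pairwise_cat ss tt !andbT; apply/allrelP => p p' ps pt.
      by move/allP : su => /(_ p ps); move/allP : tu => /(_ p' pt); lra.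
    + rewrite big_cat/=.
      have -> : U `&` `[u, w[ = (U `&` `[u, v[) `|` (U `&` `[v, w[).
        by rewrite -setIUr -itv_bndbnd_setU// ?bnd_simp.
      rewrite measureU; [exact: leeD|exact: measurableI|exact: measurableI|].
      by rewrite -subset0 => x /= [[_ +] [_ +]]; rewrite !in_itv/=; lra.
    + have -> : f w - f u = (f w - f v) + (f v - f u) by ring.
      by rewrite big_cat/= (le_trans (ler_normD _ _))//; lra.
  (* Around an exceptional point the segment fits in [U] and is listed whole; around any other point
     nothing is listed and the zero derivative suffices. *)
  - move=> x xab; have [Zx|nZx] := pselect (Z x).
      have /nbhs_ballP[k /= k0 kU] : nbhs x U by apply: open_nbhs_nbhs; split => //; exact: ZU.
      exists k => // u v au vb xu ux xv vx; exists [:: (u, v)]; split => //=.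
      + by rewrite !lexx andbT/=; lra.
      + rewrite big_seq1/= setIidr; last first.
          by move=> t /=; rewrite in_itv/= => tuv; apply: kU; rewrite /ball/= ltr_distlC; lra.
        rewrite lebesgue_measure_itv/= lte_fin; case: ifPn => // uv.
        by rewrite lee_fin; lra.
      + by rewrite big_seq1/= lerDr mulr_ge0 ?(ltW e'0)//; lra.
    have xab' : x \in `]a, b[.
      rewrite in_itv/=; apply/andP; split; rewrite lt_neqAle; apply/andP; split; try lra.
        by apply/eqP => E; apply: nZx; right; left.
      by apply/eqP => E; apply: nZx; right; right.
    have [dfx dfx0] : is_derive x 1 f 0.
      by apply: contrapT => h; apply: nZx; left; apply: NP => /= /(_ xab').
    have : h^-1 *: (f (h *: 1 + x) - f x) @[h --> 0^'] --> 'D_1 f x by exact: dfx.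
    rewrite dfx0 => /cvgrPdist_le /(_ _ e'0); rewrite near_withinE near_nbhs.
    move=> /nbhs_ballP[k /= k0 kP].
    have {}kP t : `|t - x| < k -> `|f t - f x| <= e' * `|t - x|.
      have [->|tx] := eqVneq t x; first by rewrite !subrr normr0 mulr0.
      move=> tk; have := kP (t - x); rewrite /ball/= sub0r normrN => /(_ tk).
      have tx0 : t - x != 0 by rewrite subr_eq0.
      move=> /(_ tx0); rewrite /GRing.scale/= mulr1 subrK sub0r normrN normrM normfV.
      by rewrite mulrC ler_pdivrMr// normr_gt0.
    exists k => // u v au vb xu ux xv vx; exists [::]; rewrite !big_nil; split => //.
    (* Since [u <= x <= v], the errors [e' * (x - u)] and [e' * (v - x)] add up to exactly
       [e' * (v - u)]. *)
    rewrite addr0; have -> : f v - f u = (f v - f x) - (f u - f x) by ring.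
    rewrite (le_trans (ler_normB _ _))//.
    have := kP v; have := kP u; rewrite !ltr_norml.
    by rewrite (ler0_norm (_ : u - x <= 0)) ?(ger0_norm (_ : 0 <= v - x)); lra.
move=> s [sab sp sU sf]; rewrite (le_trans sf)//.
have h1 : e' * (b - a) <= e / 2.
  rewrite /e' -mulrA ler_pM2l// invfM -mulrA ler_piMr// ?invr_ge0// mulrC ler_pdivrMr//; lra.
have h2 : \sum_(p <- s) `|f p.2 - f p.1| < e / 2.
  rewrite (eq_bigr (fun p => cmod ((f p.2)%:C - (f p.1)%:C))); last first.
    by move=> p _; rewrite /cmod/= subr0 expr0n/= addr0 sqrtr_sqr.
  apply: acd => //; rewrite -lte_fin; apply: le_lt_trans mUd; rewrite -sumEFin.
  by apply: (le_trans sU); apply: le_measure; rewrite ?inE//; exact: measurableI.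
lra.
Qed.

(** Half of [e] goes to the length term and half to the term in [y]. This carries absolute
    continuity of a derivative over to expressions combining it with Lipschitz functions. *)
Lemma abs_continuous_le a b c (y z : R -> R[i]) C : c <= b ->
  abs_continuous a b y -> 0 < C ->
  (forall u v, a <= u -> u <= v -> v <= c ->
    cmod (z v - z u) <= C * (v - u) + C * cmod (y v - y u)) ->
  abs_continuous a c z.
Proof.
move=> cb ac C0 zy e e0.
have e2 : 0 < e / (2 * C) by rewrite divr_gt0// mulr_gt0.
have [d d0 H] := ac _ e2.
exists (Num.min d (e / (2 * C))); first by rewrite lt_min d0.
move=> n u v uv tuv; rewrite lt_min => /andP[sd se].
have := H n u v _ tuv sd => /(_ _)/= hh.
have {}hh : \sum_(i < n) cmod (y (v i) - y (u i)) < e / (2 * C).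
  by apply: hh => i; have [? [? ?]] := uv i; do 2?split => //; lra.
apply: le_lt_trans (_ : C * \sum_(i < n) (v i - u i)
    + C * \sum_(i < n) cmod (y (v i) - y (u i)) < e).
  rewrite !mulr_sumr -big_split/=; apply: ler_sum => i _.
  by have [? [? ?]] := uv i; exact: zy.
have -> : e = C * (e / (2 * C)) + C * (e / (2 * C)) by field; rewrite gt_eqF.
by apply: ltrD; rewrite ltr_pM2l.
Qed.

End AbsolutelyContinuous.

(** * Piecewise continuous functions and primitives of bounded measurable functions *)

Section Primitive.
Context {R : realType}.
Local Notation mu := (@lebesgue_measure R).
Implicit Types (a b c x : R) (f h : R -> R).

Lemma cvg_eventually_bounded {T : Type} (F : set_system T) {FF : Filter F} (g : T -> R) :
  cvg (g @ F) -> exists M, \forall t \near F, `|g t| <= M.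
Proof.
move=> cg; exists (`|lim (g @ F)| + 1).
have : g @ F --> lim (g @ F) by exact: cg.
move=> /cvgrPdist_le/(_ _ ltr01); apply: filterS => t.
set l := lim _ => h; have -> : g t = l - (l - g t) by ring.
by rewrite (le_trans (ler_normB _ _))// lerD2l.
Qed.

(** Bounds on adjacent segments combine, and every point has a local bound: from continuity inside,
    from the one-sided limits at [u] and [v]. Gauge induction does the rest. *)
Lemma open_itv_continuous_bounded u v f : u < v -> {in `]u, v[, continuous f} ->
  cvg (f t @[t --> u^'+]) -> cvg (f t @[t --> v^'-]) ->
  exists M, forall t, u <= t <= v -> `|f t| <= M.
Proof.
move=> uv cf cu cv.
apply: (segment_gauge_induction
  (fun u' v' => exists M, forall t, u' <= t <= v' -> `|f t| <= M)); first exact: ltW.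
  move=> p q s pq qs [M fM] [K fK]; exists (Num.max M K) => t tps.
  rewrite le_max; have [tq|qt] := leP t q.
    by rewrite fM//; lra.
  by rewrite [X in _ || X]fK ?orbT//; lra.
move=> x xuv.
(* One-sided limits ignore the value at the point itself, so a bound off [x] is sought and [|f x|]
   enters through a maximum. *)
suff [d d0 [M fM]] : exists2 d, 0 < d & exists M, forall t, u <= t <= v ->
    x - d < t < x + d -> t != x -> `|f t| <= M.
  exists d => // p q up qv xp px xq qx; exists (Num.max M `|f x|) => t tpq.
  rewrite le_max; have [->|tx] := eqVneq t x; first by rewrite lexx orbT.
  by rewrite fM//; lra.
have [->|xu] := eqVneq x u.
  have [M] := cvg_eventually_bounded _ _ cu.
  move=> /nbhs_ballP[d /= d0 dM]; exists d => //; exists M => t tuv td tu.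
  apply: dM; first by rewrite /ball/= ltr_distlC; lra.
  by rewrite lt_neqAle eq_sym tu/=; lra.
have [->|xv] := eqVneq x v.
  have [M] := cvg_eventually_bounded _ _ cv.
  move=> /nbhs_ballP[d /= d0 dM]; exists d => //; exists M => t tuv td tu.
  apply: dM; first by rewrite /ball/= ltr_distlC; lra.
  by rewrite lt_neqAle tu/=; lra.
have xin : x \in `]u, v[ by rewrite in_itv/= !lt_neqAle xv eq_sym xu.
have [M] := cvg_eventually_bounded _ _ (cvgP _ (cf x xin)).
move=> /nbhs_ballP[d /= d0 dM]; exists d => //; exists M => t tuv td tu.
by apply: dM; rewrite /ball/= ltr_distlC; lra.
Qed.

Lemma piecewise_continuous_measurable_bounded a b f : piecewise_continuous a b f ->
  measurable_fun `[a, b] f /\ exists2 M, 0 < M & forall t, a <= t <= b -> `|f t| <= M.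
Proof.
move=> [s sab fs].
suff [mf [M fM]] : measurable_fun `[a, b] f /\ exists M, forall t, a <= t <= b -> `|f t| <= M.
  split=> //; exists (`|M| + 1); first by rewrite ltr_wpDl.
  by move=> t /fM h; rewrite (le_trans h)// (le_trans (ler_norm _))// lerDl.
elim: s a sab fs => [|c s ih] a sab fs.
  rewrite (itv_partition_nil sab) set_itv1; split; first exact: measurable_fun_set1.
  by exists `|f b| => t tb; have -> : t = b by lra.
have ac : a < c by case: sab => /= /andP[].
have cb : c <= b := itv_partition_le (itv_partition_cons sab).
have [mf [M fM]] := ih c (itv_partition_cons sab) (fun i => fs i.+1).
have [cf ca cc] := fs 0%N isT.
have [K fK] := open_itv_continuous_bounded _ _ _ ac cf ca cc.
split.
  have -> : `[a, b]%classic = `[a, c] `|` `[c, b] :> set R.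
    apply/seteqP; split=> t /=; rewrite !in_itv/=; last by case; lra.
    by have [tc|tc] := leP t c; [left|right]; lra.
  apply/measurable_funU => //; split=> //.
  (* Endpoints do not affect measurability, so continuity on the open piece is enough. *)
  apply: (@measurable_fun_itv_cc _ _ _ false true).
  apply: open_continuous_measurable_fun; first exact: interval_open.
  by move=> t; rewrite inE/= => tac; exact: cf.
exists (Num.max M K) => t tab; rewrite le_max; have [tc|tc] := leP t c.
  by rewrite [X in _ || X]fK ?orbT//; lra.
by rewrite fM//; lra.
Qed.

Context (a b : R) (h : R -> R) (M : R) (mh : measurable_fun `[a, b] h)
  (hM : forall t, a <= t <= b -> `|h t| <= M).

Let H x := (\int[mu]_(t in `[a, x]) h t)%R.

Lemma bounded_measurable_integrable : mu.-integrable `[a, b] (EFin \o h).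
Proof.
apply: measurable_bounded_integrable => //=.
  by rewrite lebesgue_measure_itv/=; case: ifP => _; rewrite ltry.
exists M; split; first exact: num_real.
by move=> N MN t /=; rewrite in_itv/= => /hM htM; rewrite (le_trans htM)// ltW.
Qed.

Lemma Rintegral_primitive_lipschitz u v : a <= u -> u <= v -> v <= b ->
  `|H v - H u| <= M * (v - u).
Proof.
move=> au uv vb.
have hi : mu.-integrable `[a, v] (EFin \o h).
  apply: integrableS bounded_measurable_integrable => //=.
  by move=> t /=; rewrite !in_itv/=; lra.
rewrite /H Rintegral_itvB// ?bnd_simp//.
have hi' : mu.-integrable `]u, v] (EFin \o h).
  by apply: integrableS hi => //= t /=; rewrite !in_itv/=; lra.
rewrite (le_trans (le_normr_Rintegral _ _))//=.
have -> : M * (v - u) = \int[mu]_(t in `]u, v]) M.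
  rewrite Rintegral_cst//= lebesgue_measure_itv/= lte_fin.
  by case: ifPn => // ; rewrite -leNgt => vu; congr (_ * _); rewrite /=; lra.
apply: le_Rintegral => //=.
- have := integrable_norm hi'; exact.
- apply/integrableP; split; first exact/measurable_EFinP.
  rewrite integral_cst//= lebesgue_measure_itv/= lte_fin.
  by case: ifP => _; rewrite ?mule0 ?ltry//= -EFinM ltry.
- by move=> t; rewrite /= in_itv/= => tuv; apply: hM; lra.
Qed.

Lemma Rintegral_primitive_is_derive :
  {ae mu, forall x, x \in `]a, b[ -> is_derive x 1 H (h x)}.
Proof.
(* Extension by zero is integrable on the whole line, so the Lebesgue form of the fundamental
   theorem applies; near an interior point both primitives agree. *)
pose g := h \_ `[a, b].
have ig : mu.-integrable setT (EFin \o g).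
  have := bounded_measurable_integrable.
  by rewrite integrable_mkcond//= (restrict_EFin h).
have lg : locally_integrable setT g by apply: open_integrable_locally => //; exact: openT.
have gi y : mu.-integrable `[a, y] (EFin \o g) by apply: integrableS ig.
have := FTC1 gi lg.
apply: filterS; first exact: (ae_filter_ringOfSetsType mu).
move=> x /= gx; rewrite in_itv/= => /andP[ax xb].
have [|dG Gx] := gx; first by rewrite lte_fin.
have gh t : a <= t <= b -> g t = h t.
  by move=> tab; rewrite /g patchE mem_set//= in_itv.
rewrite -gh; last by rewrite !ltW.
apply: (near_eq_is_derive (f := fun x => \int[mu]_(t in `[a, x]) g t)).
  near=> z; apply: eq_Rintegral => t; rewrite inE/= in_itv/= => taz; apply: gh.
  have zb : z < b by near: z; exact: lt_nbhsl.
  lra.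
by split=> //; rewrite -Gx derive1E.
Unshelve. all: by end_near. Qed.

End Primitive.

(** * The Wronskian of the real and imaginary parts of a solution *)

Section SturmLiouville.
Context {R : realType}.
Local Notation mu := (@lebesgue_measure R).
Implicit Types (a b c x : R) (f q r : R -> R) (y : R -> R[i]) (l : R[i]).

Lemma sqr_cmod (z : R[i]) : cmod z ^+ 2 = complex.Re z ^+ 2 + complex.Im z ^+ 2.
Proof. by case: z => u v; rewrite /cmod/= sqr_sqrtr// addr_ge0// sqr_ge0. Qed.

Lemma cmod_ge_Re (z : R[i]) : `|complex.Re z| <= cmod z.
Proof.
case: z => u v; rewrite /cmod/= -sqrtr_sqr ler_sqrt ?addr_ge0 ?sqr_ge0//.
by rewrite lerDl sqr_ge0.
Qed.

Lemma cmod_ge_Im (z : R[i]) : `|complex.Im z| <= cmod z.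
Proof.
case: z => u v; rewrite /cmod/= -sqrtr_sqr ler_sqrt ?addr_ge0 ?sqr_ge0//.
by rewrite lerDr sqr_ge0.
Qed.

(** Multiply the equation by the conjugate of [Y] and take imaginary parts: the terms with [q] and
    [complex.Re l] are real and drop out. *)
Lemma sl_equation_Im (l Y D : R[i]) (q r : R) : - D + q%:C * Y = l * r%:C * Y ->
  complex.Re Y * complex.Im D - complex.Re D * complex.Im Y =
  - complex.Im l * (r * (complex.Re Y ^+ 2 + complex.Im Y ^+ 2)).
Proof.
case: l Y D => al be [p s] [A B]; simpc => -[eA eB] /=.
have -> : A = q * p - (al * r * p - be * r * s) by rewrite -eA; ring.
have -> : B = q * s - (al * r * s + be * r * p) by rewrite -eB; ring.
ring.
Qed.

(** This is the imaginary part of the conjugate of [y] times [y']. *)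
Definition wronskian a b y x : R :=
  re_part y x * deriv_in a b (im_part y) x - deriv_in a b (re_part y) x * im_part y x.

Lemma cC1_on_bounds a b y : cC1_on a b y -> exists2 K, 0 < K &
  (forall x, a <= x <= b ->
    [/\ `|re_part y x| <= K, `|im_part y x| <= K,
        `|deriv_in a b (re_part y) x| <= K & `|deriv_in a b (im_part y) x| <= K]) /\
  (forall u v, a <= u -> u <= v -> v <= b ->
    `|re_part y v - re_part y u| <= K * (v - u) /\
    `|im_part y v - im_part y u| <= K * (v - u)).
Proof.
move=> [Cre Cim].
have [K1 _ b1] := continuous_segment_bounded _ _ _ (derivable_in_continuous _ _ _ Cre.1).
have [K2 _ b2] := continuous_segment_bounded _ _ _ (derivable_in_continuous _ _ _ Cim.1).
have [K3 _ b3] := continuous_segment_bounded _ _ _ Cre.2.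
have [K4 _ b4] := continuous_segment_bounded _ _ _ Cim.2.
have [K5 K50 b5] := C1_on_lipschitz _ _ _ Cre.
have [K6 _ b6] := C1_on_lipschitz _ _ _ Cim.
pose K := Num.max K1 (Num.max K2 (Num.max K3 (Num.max K4 (Num.max K5 K6)))).
have [KK1 KK2 KK3] : [/\ K1 <= K, K2 <= K & K3 <= K] by rewrite /K !le_max !lexx !orbT.
have [KK4 KK5 KK6] : [/\ K4 <= K, K5 <= K & K6 <= K] by rewrite /K !le_max !lexx !orbT.
exists K; first exact: lt_le_trans KK5.
split=> [x xab|u v au uv vb].
  have := b1 x xab; have := b2 x xab; have := b3 x xab; have := b4 x xab.
  by move=> *; split; lra.
have uv0 : 0 <= v - u by rewrite subr_ge0.
by split; [apply: le_trans (b5 _ _ au uv vb) _|apply: le_trans (b6 _ _ au uv vb) _];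
  rewrite ler_wpM2r.
Qed.

(** A zero derivative almost everywhere does not by itself give constancy, so [F] must also be shown
    absolutely continuous: the increments of [y'] are controlled by hypothesis, and [y] and
    [ghost_G] are Lipschitz. *)
Lemma sl_solution_wronskian a b q r l y : piecewise_continuous a b r ->
  sl_solution a b q r l y ->
  forall x, a <= x <= b ->
    wronskian a b y x - wronskian a b y a = - complex.Im l * ghost_G a r y x.
Proof.
move=> pr [[Cy acy] ae_eq] x /andP[ax xb].
have [K K0 [Kb KL]] := cC1_on_bounds _ _ _ Cy.
have [mr [N N0 rN]] := piecewise_continuous_measurable_bounded _ _ _ pr.
have [[Cre _] [Cim _]] := Cy.
pose h t := r t * cmod (y t) ^+ 2.
have mh : measurable_fun `[a, b] h.
  have -> : h = fun t => r t * (re_part y t ^+ 2 + im_part y t ^+ 2).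
    by apply/funext => t; rewrite /h sqr_cmod.
  apply: measurable_funM => //.
  apply: measurable_funD; apply: measurable_funX; apply: subspace_continuous_measurable_fun => //;
    exact: derivable_in_continuous.
set M := N * (K ^+ 2 + K ^+ 2).
have hM t : a <= t <= b -> `|h t| <= M.
  move=> tab; have [re im _ _] := Kb t tab.
  rewrite /h sqr_cmod normrM; apply: ler_pM; rewrite ?normr_ge0 ?rN//.
  rewrite ger0_norm ?addr_ge0 ?sqr_ge0// -[_ ^+ 2]real_normK ?num_real//.
  rewrite -[complex.Im _ ^+ 2]real_normK ?num_real//.
  by apply: lerD; rewrite ler_sqr ?nnegrE ?(ltW K0).
have M0 : 0 <= M by rewrite mulr_ge0 ?(ltW N0)// addr_ge0// sqr_ge0.
pose F t := wronskian a b y t + complex.Im l * ghost_G a r y t.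
suff : F x = F a.
  rewrite /F /ghost_G [in X in _ = X]set_itv1 Rintegral_set1; lra.
(* [C] has to dominate [2 * K], the coefficient of the increment of [y'], and the coefficient
   [2 * K ^+ 2 + |Im l| * M] of [v - u]. *)
pose C := 1 + 2 * K + 2 * K ^+ 2 + `|complex.Im l| * M.
have lM0 : 0 <= `|complex.Im l| * M by rewrite mulr_ge0.
have K20 : 0 < K ^+ 2 by rewrite exprn_gt0.
have C1 : 2 * K <= C by rewrite /C; lra.
have C2 : 2 * K ^+ 2 + `|complex.Im l| * M <= C by rewrite /C; lra.
have C0 : 0 < C by lra.
apply: abs_continuous_derive0_const => //.
  apply: (abs_continuous_le _ _ _ _ _ C xb acy C0) => u v au uv vx.
  have vb : v <= b by lra.
  have -> : cmod ((F v)%:C - (F u)%:C) = `|F v - F u|.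
    by rewrite /cmod/= subr0 expr0n/= addr0 sqrtr_sqr.
  set z := cderiv_in a b y v - _.
  (* Discrete product rule: each increment, of [y'] (that is [z]), of [y] or of [ghost_G], comes
     with a bounded factor. *)
  have -> : F v - F u =
    re_part y v * complex.Im z + (re_part y v - re_part y u) * deriv_in a b (im_part y) u
    - im_part y v * complex.Re z - (im_part y v - im_part y u) * deriv_in a b (re_part y) u
    + complex.Im l * (ghost_G a r y v - ghost_G a r y u).
    by rewrite /F /wronskian /z /=; ring.
  have [|rv iv _ _] := Kb v; first lra.
  have [|_ _ ru iu] := Kb u; first lra.
  have [rL iL] := KL u v au uv vb.
  have GL := Rintegral_primitive_lipschitz _ _ _ _ mh hM u v au uv vb.
  have zK s t : `|s| <= K -> `|t| <= cmod z -> `|s * t| <= K * cmod z.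
    by move=> sK tz; rewrite normrM ler_pM.
  have LK s t : `|s| <= K * (v - u) -> `|t| <= K -> `|s * t| <= K ^+ 2 * (v - u).
    by move=> sK tz; rewrite normrM expr2 mulrAC ler_pM.
  have := zK _ _ rv (cmod_ge_Im z); have := zK _ _ iv (cmod_ge_Re z).
  have := LK _ _ rL iu; have := LK _ _ iL ru.
  have : `|complex.Im l * (ghost_G a r y v - ghost_G a r y u)| <=
      `|complex.Im l| * M * (v - u) by rewrite normrM -mulrA ler_wpM2l.
  have : 2 * K * cmod z <= C * cmod z by rewrite ler_wpM2r// (le_trans _ (cmod_ge_Re z)).
  have : (2 * K ^+ 2 + `|complex.Im l| * M) * (v - u) <= C * (v - u).
    by rewrite ler_wpM2r// subr_ge0.
  set I := complex.Im l * _; set Q := `|complex.Im l| * M.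
  rewrite !ler_norml; lra.
have prim := Rintegral_primitive_is_derive _ _ _ _ mh hM.
(* At almost every point both the equation and the derivative of [ghost_G] are available; in the
   derivative of the Wronskian the products of first derivatives cancel. *)
apply: filterS2 ae_eq prim; first exact: (ae_filter_ringOfSetsType mu).
move=> t eqt primt; rewrite in_itv/= => tax.
have tab : t \in `]a, b[ by rewrite in_itv/=; lra.
have tab' : t \in `[a, b] by rewrite in_itv/=; lra.
have [[dre dim]] := eqt tab'.
have D1 := derivable_in_is_derive _ _ _ _ tab (Cre t tab').
have D2 := derivable_in_is_derive _ _ _ _ tab (Cim t tab').
have D3 := derivable_in_is_derive _ _ _ _ tab dre.
have D4 := derivable_in_is_derive _ _ _ _ tab dim.
have DG := primt tab.
have DF := is_deriveD (is_deriveB (is_deriveM D1 D4) (is_deriveM D3 D2))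
  (is_deriveZ (complex.Im l) DG).
move=> /sl_equation_Im /= eqn; apply: (is_derive_eq DF).
move: eqn; rewrite /h sqr_cmod /GRing.scale /re_part /im_part /cderiv_in /=; lra.
Qed.

(** The derivative of [f / g] is minus the Wronskian over [g ^+ 2], hence negative, and the mean
    value theorem applies. *)
Lemma quotient_decreasing (f g df dg : R -> R) c d : c < d ->
  (forall t, c <= t <= d -> is_derive t 1 f (df t)) ->
  (forall t, c <= t <= d -> is_derive t 1 g (dg t)) ->
  (forall t, c <= t <= d -> g t != 0) ->
  (forall t, c <= t <= d -> 0 < f t * dg t - df t * g t) ->
  f d / g d < f c / g c.
Proof.
move=> cd Df Dg g0 W0.
pose D t := - (f t * dg t - df t * g t) / g t ^+ 2.
have Dq t : c <= t <= d -> is_derive t 1 (f * (fun t => (g t)^-1)) (D t).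
  move=> tcd; have Dft := Df t tcd; have Dgt := Dg t tcd.
  have gt0 := g0 t tcd.
  apply: (is_derive_eq (is_deriveM Dft (is_deriveV gt0 Dgt))).
  by rewrite /D /GRing.scale/=; field.
have [||s scd E] := @MVT R (f * (fun t => (g t)^-1)) D c d cd.
- by move=> t; rewrite in_itv/= => tcd; apply: Dq; lra.
- apply: derivable_within_continuous => t; rewrite in_itv/= => tcd.
  by have [] := Dq t tcd.
rewrite in_itv/= in scd; have scd' : c <= s <= d by lra.
rewrite -subr_lt0; have -> : f d / g d - f c / g c = D s * (d - c) by exact: E.
rewrite nmulr_rlt0 ?subr_gt0// /D mulNr oppr_lt0 divr_gt0 ?W0//.
by rewrite exprn_even_gt0//= g0.
Qed.

End SturmLiouville.

(** * Signs and zeros of the two parts to the right of the last zero *)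

Theorem corollary6 (R : realType) (a b : R) (hab : a < b)
  (q r : R -> R)
  (hq : piecewise_continuous a b q) (hr : piecewise_continuous a b r)
  (hnd : non_definite a b q r)
  (l : R[i]) (hl : 0 < complex.Im l)
  (y : R -> R[i]) (hy : complex_ghost a b q r l y)
  (phi psi : R -> R) (hphi : phi = re_part y) (hpsi : psi = im_part y)
  (hG : forall x, x \in `]a, b[ -> ghost_G a r y x < 0)
  (hpsib : 0 < deriv_in a b psi b)
  (x0 : R) (hx0 : x0 \in `]a, b[) (hx0zero : psi x0 = 0)
  (hx0max : forall x, x \in `]a, b[ -> psi x = 0 -> x <= x0) :
  (0 < deriv_in a b phi b -> forall x, x \in `]x0, b[ -> phi x < 0) /\
  (deriv_in a b phi b < 0 -> vanishes_once phi `]x0, b[) /\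
  (deriv_in a b phi b = 0 ->
     (forall x, x \in `]x0, b[ -> phi x < 0) \/ vanishes_once phi `]x0, b[).
Proof.
have [_ [sl ya yb _]] := hy.
have [[[Cphi Cpsi] _] _] := sl; rewrite -hphi in Cphi; rewrite -hpsi in Cpsi.
have [Dphi _] := Cphi; have [Dpsi _] := Cpsi.
(* Both parts vanish at [a], so the Wronskian starts from zero. *)
have W_gt0 x : a < x < b ->
    0 < phi x * deriv_in a b psi x - deriv_in a b phi x * psi x.
  move=> xab; have Gx : ghost_G a r y x < 0 by apply: hG; rewrite in_itv.
  have xab' : a <= x <= b by lra.
  have := sl_solution_wronskian _ _ _ _ _ _ hr sl x xab'.
  rewrite /wronskian -hphi -hpsi.
  have -> : phi a = 0 by rewrite hphi /re_part ya.
  have -> : psi a = 0 by rewrite hpsi /im_part ya.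
  rewrite mul0r mulr0 !subr0 => ->; rewrite mulNr oppr_gt0.
  by rewrite pmulr_rlt0.
have phib : phi b = 0 by rewrite hphi /re_part yb.
have psib : psi b = 0 by rewrite hpsi /im_part yb.
have bab : b \in `[a, b] by rewrite in_itv/=; lra.
rewrite in_itv/= in hx0.
have cont f : {in `[a, b], forall x, derivable_in a b f x} ->
    forall u v, a <= u -> v <= b -> {within `[u, v], continuous f}.
  move=> df u v au vb; apply: continuous_subspaceW (derivable_in_continuous _ _ _ df).
  by move=> t /=; rewrite !in_itv/=; lra.
(* As [f b = 0], just left of [b] the sign of [f] is opposite to that of its slope; the witness lies
   beyond [c] and within [d] of [b]. *)
have near_b f c : derivable_in a b f b -> deriv_in a b f b != 0 -> f b = 0 -> a <= c < b ->
    exists2 t, c < t < b & deriv_in a b f b * f t < 0.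
  move=> dfb dfb0 fb0 cb; have [d d0 fd] := derivable_in_increment_sign _ _ _ _ dfb dfb0.
  pose t := Num.max ((c + b) / 2) (b - d / 2).
  have [t1 t2 t3] : [/\ (c + b) / 2 <= t, b - d / 2 <= t & t < b].
    by rewrite /t !le_max !lexx orbT gt_max; split=> //; lra.
  exists t; first lra.
  have := fd t; rewrite fb0 subr0 mulrA ltr_norml => /(_ _ _ _)/= h.
  have {}h : 0 < deriv_in a b f b * f t * (t - b) by apply: h; [lra|lra|rewrite lt_eqF].
  by move: h; rewrite nmulr_lgt0// subr_lt0.
(* The slope at [b] makes [psi] negative near [b]; a nonnegative value at [x] would give a zero
   beyond [x0], against maximality. *)
have psi_lt0 x : x0 < x < b -> psi x < 0.
  move=> xb; rewrite ltNge; apply/negP => psix.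
  have [|t tb psit] := near_b psi x (Dpsi b bab) (lt0r_neq0 hpsib) psib; first lra.
  have [|||c cxt psic] := IVT_zero psi x t.
  - lra.
  - by apply: cont => //; lra.
  - rewrite pmulr_rlt0// in psit; nra.
  have := hx0max c; rewrite in_itv/= => /(_ _ psic) h; have : c <= x0 by apply: h; lra.
  lra.
(* At [x0] the Wronskian reduces to [phi x0] times the slope of [psi]. If [phi x0] were nonnegative,
   that slope would be positive and [psi] positive just right of [x0]. *)
have phix0 : phi x0 < 0.
  have := W_gt0 x0 hx0; rewrite hx0zero mulr0 subr0 => W0.
  rewrite ltNge; apply/negP => phix0.
  have Dx0 : 0 < deriv_in a b psi x0 by nra.
  have x0ab : x0 \in `[a, b] by rewrite in_itv/=; lra.
  have [d d0 psid] := derivable_in_increment_sign _ _ _ _ (Dpsi x0 x0ab) (lt0r_neq0 Dx0).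
  pose t := Num.min ((x0 + b) / 2) (x0 + d / 2).
  have [t1 t2 t3] : [/\ t <= (x0 + b) / 2, t <= x0 + d / 2 & x0 < t].
    by rewrite /t !ge_min !lexx orbT lt_min; split=> //; lra.
  have psit : psi t < 0 by apply: psi_lt0; lra.
  have := psid t; rewrite hx0zero subr0 ltr_norml pmulr_rgt0// => h.
  have {}h : 0 < psi t * (t - x0) by apply: h; [lra|lra|rewrite gt_eqF].
  by move: h; rewrite pmulr_lgt0 ?subr_gt0//; lra.
have ratio c d : x0 < c -> c < d -> d < b -> phi d / psi d < phi c / psi c.
  move=> x0c cd db.
  apply: (quotient_decreasing _ _ (deriv_in a b phi) (deriv_in a b psi)) => // t tcd.
  - by apply: derivable_in_is_derive; [|apply: Dphi]; rewrite in_itv/=; lra.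
  - by apply: derivable_in_is_derive; [|apply: Dpsi]; rewrite in_itv/=; lra.
  - by rewrite lt_eqF// psi_lt0//; lra.
  - by apply: W_gt0; lra.
(* Two zeros would make the strictly decreasing ratio vanish twice. *)
have zero_uniq c : x0 < c < b -> phi c = 0 -> vanishes_once phi `]x0, b[.
  move=> cb phic; exists c; split; first by rewrite in_itv.
  move=> d [+ phid]; rewrite in_itv/= => db.
  have [cd|dc|//] := ltgtP c d.
  - have : phi d / psi d < phi c / psi c by apply: ratio; lra.
    by rewrite phic phid !mul0r ltxx.
  - have : phi c / psi c < phi d / psi d by apply: ratio; lra.
    by rewrite phic phid !mul0r ltxx.
have phi_zero t : x0 < t < b -> 0 <= phi t -> exists2 c, x0 < c <= t & phi c = 0.
  move=> tb phit; have [|||c cx phic] := IVT_zero phi x0 t.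
  - lra.
  - by apply: cont => //; lra.
  - by rewrite nmulr_rle0.
  (* The intermediate value theorem allows [c = x0], which [phi x0 < 0] excludes. *)
  exists c => //; move: cx => /andP[x0c ->]; rewrite lt_neqAle x0c !andbT.
  by apply/eqP => E; move: phix0; rewrite E phic ltxx.
split; [|split] => Db.
(* Near [b] both functions are negative and the ratio is positive, whereas [0 <= phi x] would make
   it nonpositive at an earlier point. *)
- move=> x; rewrite in_itv/= => xb; rewrite ltNge; apply/negP => phix.
  have [|t tb] := near_b phi x (Dphi b bab) (lt0r_neq0 Db) phib; first lra.
  rewrite pmulr_rlt0// => phit.
  have : phi t / psi t < phi x / psi x by apply: ratio; lra.
  have psit : psi t < 0 by apply: psi_lt0; lra.
  have psix : psi x < 0 by apply: psi_lt0; lra.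
  have : 0 < phi t / psi t by rewrite nmulr_rgt0// invr_lt0.
  have : phi x / psi x <= 0 by rewrite mulr_ge0_le0// invr_le0 ltW.
  lra.
(* Here [phi] is positive just left of [b], which with [phi x0 < 0] produces the zero. *)
- have [|t tb] := near_b phi x0 (Dphi b bab) (ltr0_neq0 Db) phib; first lra.
  rewrite nmulr_rlt0// => phit.
  have [|c ct phic] := phi_zero t tb; first exact: ltW.
  by apply: (zero_uniq c) => //; lra.
(* The slope at [b] gives no sign, so the split is on whether [phi] stays negative; any nonnegative
   value yields the zero. *)
- have [phi0|phi_ge0] := pselect (forall x, x \in `]x0, b[ -> phi x < 0); [by left|right].
  move/existsNP : phi_ge0 => [t /not_implyP[+ /negP]]; rewrite in_itv/= -leNgt => tb phit.
  have [c ct phic] := phi_zero t tb phit.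
  by apply: (zero_uniq c) => //; lra.
Qed.
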